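(* For any positive integer $n$ and any subset $J \subseteq [n-1]$, \[ |\{\pi \in OC(n) : \operatorname{Des}(\pi) = J\}| = |\{\pi \in EC(n) : \operatorname{Des}(\pi) = [n-1] \setminus J\}|. \]
   Context: $[m] := \{1,2,\ldots,m\}$ (so $[0]=\varnothing$). $S_n$ is the symmetric group on $[n]$. The descent set of $\pi = [\pi_1,\ldots,\pi_n] \in S_n$ (one-line notation, $\pi_i=\pi(i)$) is $\operatorname{Des}(\pi) := \{1 \le i \le n-1 : \pi_i > \pi_{i+1}\}$. For every positive integer $n$, $OC(n)$ is the set of all $\pi \in S_n$ all of whose cycles have odd length (fixed points count as cycles of length 1). For $n$ even, $EC(n)$ is the set of all $\pi\in S_n$ all of whose cycles have even length. For $n$ odd, $EC(n)$ is the set of all $\pi \in S_n$ having exactly one fixed point and all of whose other cycles have even length. *)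

(* Defs.v *)
From mathcomp Require Import all_boot all_fingroup.

Set Implicit Arguments.
Unset Strict Implicit.
Unset Printing Implicit Defensive.

(* Everything is shifted down by one: [n] is 'I_n and [n-1] is 'I_n.-1, so  *)
(* i : 'I_n.-1 stands for the position i+1, which compares the entries of   *)
(* the one-line notation at the indices i and i+1 of 'I_n.                  *)

Definition pos_left (n : nat) (i : 'I_n.-1) : 'I_n := widen_ord (leq_pred n) i.

Lemma pos_right_proof (n : nat) (i : 'I_n.-1) : i.+1 < n.
Proof. by rewrite -ltn_predRL. Qed.

Definition pos_right (n : nat) (i : 'I_n.-1) : 'I_n :=
  Ordinal (pos_right_proof i).

Definition Des (n : nat) (p : 'S_n) : {set 'I_n.-1} :=
  [set i : 'I_n.-1 | p (pos_left i) > p (pos_right i)].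

Definition OC (n : nat) : {set 'S_n} :=
  [set p : 'S_n | [forall C in porbits p, odd #|C|]].

(* porbits lists the orbits of size 1 too, so for odd n they are excluded   *)
(* from the parity condition and counted separately.                        *)
Definition EC (n : nat) : {set 'S_n} :=
  if odd n then
    [set p : 'S_n | (#|[set x | p x == x]| == 1)
                    && [forall C in porbits p, (#|C| != 1) ==> ~~ odd #|C|]]
  else
    [set p : 'S_n | [forall C in porbits p, ~~ odd #|C|]].

(* Main.v *)
Require Import Defs.
From mathcomp Require Import all_boot all_fingroup all_algebra.

(** Inclusion-exclusion reduces the claim to: among the permutations that are
    increasing on each block of consecutive positions cut out by [J], as many
    lie in [OC n] as, among those that are decreasing on each block, lie in
    [EC n].

    Gessel-Reutenauer: label every point by its block and attach to [x] the
    periodic word of the labels met along the orbit of [x].  Points are sorted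
    by their words (lexicographically in the increasing case, in the
    alternating lexicographic order in the decreasing case), so either kind of
    permutation is determined by the multiset of its words, and every
    shift-invariant multiset of words of the given content occurs.  Such a
    multiset is a multiset of primitive necklaces.  In the increasing case the
    cycles correspond to the necklaces; in the decreasing case the points with
    a given word of odd period are reversed by the first return map, so that
    two copies of a necklace of odd length d fuse into one cycle of length 2d.
    Hence [OC] means that all necklaces are odd, and [EC] (n even) that each odd
    necklace has even multiplicity.

    Let E, O, A be the generating functions, by content, of the multisets of
    even necklaces, of odd necklaces, and of those with even multiplicities on
    the odd ones.  Then A = E * O(x) * O(-x), and E * O = 1 / (1 - p_1) since a
    multiset of necklaces is the same as a word.  So A * (1 - p_1) = O(-x); as A
    lives in even degrees, O = A in even degrees and O = p_1 * A in odd ones. *)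

Set Implicit Arguments.
Unset Strict Implicit.
Unset Printing Implicit Defensive.

(** * Matching fibers and sorted labellings *)

(* Throughout, [e = false] is the increasing and [e = true] the decreasing case. *)
Definition ltx (e : bool) (i j : nat) : bool := if e then j < i else i < j.

Lemma ltx_trans e : transitive (ltx e).
Proof. case: e => [y x z|]; last exact: ltn_trans. by move=> h1 h2; apply: ltn_trans h2 h1. Qed.

Lemma ltxx e i : ltx e i i = false.
Proof. by case: e; apply: ltnn. Qed.

Lemma ltx_total e i j : i != j -> ltx e i j || ltx e j i.
Proof. by case: e; rewrite /ltx neq_ltn // orbC. Qed.

(** Reduce [j] modulo the cycle length; the iterates before the first return to [x] are distinct. *)
Lemma perm_dvd_porbit (T : finType) (s : {perm T}) x j :
  ((s ^+ j)%g x == x) = (#|porbit s x| %| j).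
Proof.
set c := #|porbit s x|.
have c0 : 0 < c by rewrite lt0n card_porbit_neq0.
have sc : (s ^+ c)%g x = x by rewrite permX iter_porbit.
have scq q : (s ^+ (q * c))%g x = x.
  elim: q => [|q IH]; first by rewrite mul0n expg0 perm1.
  by rewrite mulSn expgD permM sc.
rewrite {1}(divn_eq j c) expgD permM scq /dvdn.
apply/eqP/eqP => [h|->]; last by rewrite expg0 perm1.
have lt : j %% c < c by rewrite ltn_mod.
apply/eqP; rewrite -(nth_uniq x _ _ (uniq_traject_porbit s x)) ?size_traject //.
by rewrite !nth_traject // -permX h.
Qed.

(** If some [x] in [S] moved, its iterates would be strictly monotone, which the finite order of [t]
    forbids. *)
Lemma incr_perm_fix m (t : {perm 'I_m}) (S : {set 'I_m}) :
    {in S, forall x, t x \in S} ->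
    {in S &, forall x y : 'I_m, x < y -> t x < t y} ->
  {in S, forall x, t x = x}.
Proof.
move=> tS tI x xS.
have itS j : iter j t x \in S by elim: j => //= j; apply: tS.
have step e : ltx e x (t x) -> forall j, ltx e (iter j t x) (iter j.+1 t x).
  move=> h; elim=> // j; rewrite [iter j.+1 _ _]/= => IH.
  by case: (e) IH => IH; apply: tI => //; apply: (itS j.+1).
have no e : ~~ ltx e x (t x).
  apply/negP => h.
  have all j : ltx e x (iter j.+1 t x).
    by elim: j => // j IH; apply: ltx_trans IH _; apply: (step _ h j.+1).
  by have := all #[t]%g.-1; rewrite prednK ?order_gt0 // -permX expg_order perm1 ltxx.
apply/eqP; apply: contraT; rewrite eq_sym => /(ltx_total false).
by rewrite -[ltx _ (t x) x]/(ltx true x (t x)) (negbTE (no _)) (negbTE (no _)).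
Qed.

Section FiberMatch.
Variables (m : nat) (L : eqType).
Implicit Types g h : 'I_m -> L.

Definition fiber_mono e g (p : 'I_m -> 'I_m) :=
  forall x y, g x = g y -> x < y -> ltx e (p x) (p y).

Lemma sorted_enum_ord (A : {pred 'I_m}) : sorted (relpre val ltn) (enum A).
Proof.
rewrite /enum_mem -enumT; apply: sorted_filter.
  by move=> y x z; apply: ltn_trans.
by rewrite -sorted_map val_enum_ord iota_ltn_sorted.
Qed.

(** The i-th smallest point of each fiber of [g] is sent to the i-th smallest point of the fiber of
    [h] with the same label. *)
Lemma fiber_match_inc g h :
    (forall l, #|[set x | g x == l]| = #|[set x | h x == l]|) ->
  exists p : {perm 'I_m}, (forall x, h (p x) = g x) /\ fiber_mono false g p.
Proof.
move=> gh.
pose sg l := enum [set x | g x == l]; pose sh l := enum [set x | h x == l].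
have szE l : size (sg l) = size (sh l) by rewrite /sg /sh -!cardE gh.
pose f x := nth x (sh (g x)) (index x (sg (g x))).
have lt_i x : index x (sg (g x)) < size (sh (g x)).
  by rewrite -szE index_mem mem_enum inE.
have fh x : h (f x) = g x.
  have : f x \in sh (g x) by apply: mem_nth.
  by rewrite mem_enum inE => /eqP.
have fm : fiber_mono false g f.
  move=> x y gxy xy.
  have lt_x : index x (sg (g y)) < size (sh (g y)) by rewrite -gxy.
  (* The default of [nth] may change, the index being in range; both values now come from one sorted
     list. *)
  have -> : f x = nth y (sh (g y)) (index x (sg (g y))).
    by rewrite /f gxy; apply: set_nth_default.
  have tr : transitive (relpre val ltn : rel 'I_m).
    by move=> b a c; apply: ltn_trans.
  apply: (sorted_ltn_nth tr y (sorted_enum_ord [set z | h z == g y])); rewrite ?inE //.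
  have yin : y \in sg (g y) by rewrite mem_enum inE.
  have xin : x \in sg (g y) by rewrite mem_enum inE gxy.
  rewrite ltnNge leq_eqVlt; apply/negP => /orP[/eqP/(index_inj x yin xin) yx|].
    by rewrite yx ltnn in xy.
  move/(sorted_ltn_index tr (sorted_enum_ord [set z | g z == g y]) _ _ yin xin) => /= yx.
  by have := ltn_trans xy yx; rewrite ltnn.
have fI : injective f.
  move=> x y fxy; have gxy : g x = g y by rewrite -!fh fxy.
  apply/eqP; apply: contraT; rewrite neq_ltn => /orP[] lt.
    by have := fm _ _ gxy lt; rewrite fxy ltxx.
  by have := fm _ _ (esym gxy) lt; rewrite fxy ltxx.
exists (perm fI); split=> [x|x y gxy xy]; first by rewrite permE.
by rewrite !permE; apply: fm.
Qed.

(** For the decreasing case, match [g] increasingly with [h] composed with the order reversal, then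
    reverse back. *)
Lemma fiber_match e g h :
    (forall l, #|[set x | g x == l]| = #|[set x | h x == l]|) ->
  exists p : {perm 'I_m}, (forall x, h (p x) = g x) /\ fiber_mono e g p.
Proof.
case: e => gh; last exact: fiber_match_inc.
have [l|p [hp mp]] := @fiber_match_inc g (h \o @rev_ord m).
  rewrite gh -(card_imset _ (@rev_ord_inj m)); apply: eq_card => x.
  apply/imsetP/idP => [[y]|]; rewrite !inE; first by move=> yl ->; rewrite /= rev_ordK.
  by exists (rev_ord x); rewrite ?rev_ordK // inE.
exists (p * perm (@rev_ord_inj m))%g; split=> [x|x y gxy xy].
  by rewrite permM permE -hp.
rewrite !permM !permE /= ltn_sub2lE ?ltnS //; apply: (mp _ _ gxy xy).
Qed.

(** [p] followed by the inverse of [q] preserves each fiber of [g] and is increasing on it, hence is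
    the identity. *)
Lemma fiber_match_uniq e g h (p q : {perm 'I_m}) :
    (forall x, h (p x) = g x) -> (forall x, h (q x) = g x) ->
    fiber_mono e g p -> fiber_mono e g q -> p = q.
Proof.
move=> hp hq mp mq.
suff pq x : (p * q^-1)%g x = x.
  by apply/permP => x; rewrite -{2}(pq x) permM permKV.
have gpq y : g ((p * q^-1)%g y) = g y by rewrite permM -hq permKV hp.
apply: (@incr_perm_fix _ _ [set y | g y == g x]); rewrite ?inE // => y.
  by rewrite !inE gpq.
move=> z; rewrite !inE => /eqP gy /eqP gz yz.
have gyz : g y = g z by rewrite gy gz.
have := mp _ _ gyz yz.
rewrite -[p y](permKV q) -[p z](permKV q) -!(permM p q^-1).
have gyz' : g ((p * q^-1)%g y) = g ((p * q^-1)%g z) by rewrite !gpq.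
case: (ltngtP ((p * q^-1)%g y) ((p * q^-1)%g z)) => //.
  move=> lt; have := mq _ _ (esym gyz') lt => h1 h2.
  by have := ltx_trans h1 h2; rewrite ltxx.
by move=> /ord_inj ->; rewrite ltxx.
Qed.

End FiberMatch.

Section SortedLabelling.
Variables (m : nat) (L : finType) (le : rel L).
Hypotheses (le_tot : total le) (le_tr : transitive le) (le_anti : antisymmetric le).

Definition label_mono (w : 'I_m -> L) := forall x y : 'I_m, x < y -> le (w x) (w y).

Lemma count_codom_ord (w : 'I_m -> L) l : count_mem l (codom w) = #|[set x | w x == l]|.
Proof.
by rewrite -sum1_count big_image_cond /= -sum1_card; apply: eq_bigl => x; rewrite inE.
Qed.

Lemma label_mono_sorted (w : 'I_m -> L) : label_mono w -> sorted le (codom w).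
Proof.
move=> wm; rewrite sorted_map; have := sorted_enum_ord (mem 'I_m).
rewrite (@eq_enum _ (mem 'I_m) predT) //.
by apply: sub_sorted => x y; apply: wm.
Qed.

(** Both value lists are sorted and they are rearrangements of each other. *)
Lemma label_mono_uniq (v w : 'I_m -> L) :
    label_mono v -> label_mono w ->
    (forall l, #|[set x | v x == l]| = #|[set x | w x == l]|) ->
  v =1 w.
Proof.
move=> vm wm vw x.
have E : codom v = codom w.
  apply: (sorted_eq le_tr le_anti); try exact: label_mono_sorted.
  by apply/allP => l _ /=; rewrite !count_codom_ord vw.
by have := congr1 (fun s => nth (v x) s (enum_rank x)) E; rewrite !nth_codom enum_rankK.
Qed.

(** Sort a list holding [c l] copies of each label [l]. *)
Lemma label_mono_exists (c : L -> nat) :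
    \sum_l c l = m ->
  exists w : 'I_m -> L, label_mono w /\ (forall l, #|[set x | w x == l]| = c l).
Proof.
move=> cm.
pose s := sort le (flatten [seq nseq (c l) l | l <- enum L]).
have cnt l : count_mem l s = c l.
  rewrite (seq.permP (permEl (perm_sort le _))) count_flatten -map_comp.
  rewrite sumnE big_map big_enum (bigD1 l) //= count_nseq /= eqxx mul1n.
  by rewrite big1 ?addn0 // => i il; rewrite count_nseq /= (negbTE il).
have sz : size s == m.
  rewrite size_sort size_flatten /shape -map_comp sumnE big_map big_enum /= -cm.
  by apply/eqP; apply: eq_bigr => l _; rewrite /= size_nseq.
have sS : sorted le s by apply: sort_sorted.
clearbody s; pose t := Tuple sz.
exists (tnth t); split=> [x y xy|l]; last first.
  by rewrite -count_codom_ord -[RHS]cnt /codom /image_mem (map_tnth_enum t).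
have x0 := tnth t x; rewrite !(tnth_nth x0) /=.
apply: (sorted_leq_nth le_tr _ _ sS) => //; last exact: ltnW.
- by move=> z; have := le_tot z z; rewrite orbb.
- by rewrite inE (eqP sz).
- by rewrite inE (eqP sz).
Qed.

End SortedLabelling.

(** * Periodic words and the alternating lexicographic order *)

(* For [e = true] the comparison is reversed after each equal letter, so that
   shifting two words with equal first letters reverses their order. *)
Fixpoint altlex (e : bool) (m : nat) (u v : nat -> nat) : bool :=
  if m is m'.+1 then
    (u 0 < v 0) || (u 0 == v 0) &&
      (if e then altlex e m' (v \o S) (u \o S) else altlex e m' (u \o S) (v \o S))
  else true.

Lemma altlex_ext e m u u' v v' : u =1 u' -> v =1 v' -> altlex e m u v = altlex e m u' v'.
Proof.
elim: m u u' v v' => //= m IH u u' v v' uu vv; rewrite uu vv.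
by case: e IH => IH; congr (_ || (_ && _)); apply: IH => i /=.
Qed.

Lemma altlex_refl e m u : altlex e m u u.
Proof. by elim: m u => //= m IH u; rewrite eqxx !IH if_same orbT. Qed.

Lemma altlex_total e m u v : altlex e m u v || altlex e m v u.
Proof.
elim: m u v => //= m IH u v; case: ltngtP => //= _.
by case: e IH => IH; apply: IH.
Qed.

Lemma altlex_trans e m : transitive (altlex e m).
Proof.
elim: m => //= m IH v u w.
case: (ltngtP (u 0) (v 0)) => //= uv.
  case: (ltngtP (v 0) (w 0)) => //= vw; first by rewrite (ltn_trans uv vw).
  by rewrite -vw uv.
rewrite uv; case: (ltngtP (v 0) (w 0)) => //= _.
by case: e IH => IH h1 h2; apply: IH; eassumption.
Qed.

Lemma altlex_anti e m u v : altlex e m u v -> altlex e m v u -> forall i, i < m -> u i = v i.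
Proof.
elim: m u v => //= m IH u v.
case: (ltngtP (u 0) (v 0)) => //= uv h1 h2 [|i] // im.
have h : forall i, i < m -> (u \o S) i = (v \o S) i.
  by case: (e) h1 h2 IH => h1 h2 IH; apply: IH.
exact: h.
Qed.

Lemma altlexS e m u v : altlex e m.+1 u v = (u 0 < v 0) || (u 0 == v 0) &&
  (if e then altlex e m (v \o S) (u \o S) else altlex e m (u \o S) (v \o S)).
Proof. by []. Qed.

(** The comparison is decided at the first difference, so later letters do not matter. *)
Lemma altlex_widen e m u v i : i < m -> u i != v i -> altlex e m.+1 u v = altlex e m u v.
Proof.
elim: m u v i => // m IH u v i im uv.
rewrite altlexS [RHS]altlexS; case: (ltngtP (u 0) (v 0)) => //= uv0.
case: i im uv => [|i] im uv; first by rewrite uv0 eqxx in uv.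
by case: e IH => IH; apply: (IH _ _ i) => //=; rewrite eq_sym.
Qed.

(* A periodic word is given by its first [N] letters, [N] being a common multiple
   of all periods that occur; it will be [n`!]. *)
Section Words.
Variables (N' k : nat).
Local Notation N := N'.+1.
Definition word := {ffun 'I_N -> 'I_k}.
Implicit Types u v : word.

Definition letter u : 'I_k := u ord0.
Definition shift u : word := [ffun i => u (ordS i)].
Definition unroll u (i : nat) : nat := u (inord (i %% N)).

Lemma unroll_val u (i : 'I_N) : unroll u i = u i.
Proof. by rewrite /unroll modn_small // inord_val. Qed.

Lemma unroll0 u : unroll u 0 = letter u.
Proof. exact: (unroll_val u ord0). Qed.

Lemma unroll_shift u i : unroll (shift u) i = unroll u i.+1.
Proof.
rewrite /unroll ffunE; congr (nat_of_ord (u _)); apply: val_inj => /=.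
by rewrite !inordK ?ltn_mod // -addn1 modnDml addn1.
Qed.

Lemma shift_inj : injective shift.
Proof.
move=> u v uv; apply/ffunP => i; rewrite -[i]ord_predK.
by have /ffunP/(_ (ord_pred i)) := uv; rewrite !ffunE.
Qed.

Definition shiftp : {perm word} := perm shift_inj.

Lemma unroll_iter u i j : unroll (iter j shift u) i = unroll u (i + j).
Proof.
by elim: j u i => [|j IH] u i; rewrite ?addn0 //= unroll_shift IH addSnnS.
Qed.

Lemma word_ext u v :
  (forall j, letter (iter j shift u) = letter (iter j shift v)) -> u = v.
Proof.
move=> uv; apply/ffunP => i; apply: ord_inj; rewrite -!unroll_val.
by rewrite -[nat_of_ord i]add0n -!unroll_iter !unroll0 uv.
Qed.

Definition leW e u v := altlex e N (unroll u) (unroll v).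

Lemma leW_refl e u : leW e u u.
Proof. exact: altlex_refl. Qed.

Lemma leW_total e : total (leW e).
Proof. move=> u v; exact: altlex_total. Qed.

Lemma leW_trans e : transitive (leW e).
Proof. move=> u v w; exact: altlex_trans. Qed.

Lemma leW_anti e : antisymmetric (leW e).
Proof.
move=> u v /andP[uv vu]; apply/ffunP => i; apply: ord_inj; rewrite -!unroll_val.
exact: altlex_anti uv vu i (ltn_ord i).
Qed.

Lemma leW_letter e u v : leW e u v -> letter u <= letter v.
Proof. by rewrite /leW /= !unroll0; case: ltngtP. Qed.

(** Widening the comparison of distinct words to [N.+1] letters allows the common first letter to be
    stripped, which leaves exactly the [N] letters of the shifted words. *)
Lemma leW_shift e u v : letter u = letter v ->
  leW e u v = if e then leW e (shift v) (shift u) else leW e (shift u) (shift v).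
Proof.
move=> luv; have [->|] := eqVneq u v; first by rewrite !leW_refl if_same.
move=> uv.
have [i ui] : exists i, u i != v i.
  by apply/existsP; apply: contraT; rewrite negb_exists => /forallP h;
     case/eqP: uv; apply/ffunP => i; have := h i; rewrite negbK => /eqP.
have E := @altlex_widen e N (unroll u) (unroll v) i (ltn_ord i).
rewrite /leW -E ?unroll_val // altlexS !unroll0 luv ltnn eqxx orFb andTb.
by case: e {E}; apply: (@altlex_ext _ N) => j /=; rewrite unroll_shift.
Qed.

End Words.

(** * The Gessel-Reutenauer correspondence *)

Section GesselReutenauer.
Variables (N' k m : nat) (b : 'I_m -> 'I_k).
Local Notation N := N'.+1.
Hypothesis b_mono : forall x y : 'I_m, x < y -> b x <= b y.
Hypothesis mN : m`! %| N.
Implicit Types (p q : {perm 'I_m}) (u v : word N' k) (e : bool).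

(** Every cycle length divides [N], so [N] letters record the whole periodic word along the
    orbit. *)
Definition wordof p x : word N' k := [ffun i : 'I_N => b (iter i p x)].

Definition mult p u := #|[set x | wordof p x == u]|.

Lemma perm_expN p : (p ^+ N)%g = 1%g.
Proof.
apply/permP => x; rewrite perm1; apply/eqP; rewrite perm_dvd_porbit.
apply: dvdn_trans mN; apply: dvdn_fact.
by rewrite lt0n card_porbit_neq0 /= -[X in _ <= X]card_ord max_card.
Qed.

Lemma wordof_shift p x : wordof p (p x) = shift (wordof p x).
Proof.
apply/ffunP => i; rewrite !ffunE; congr b.
by rewrite /= -iterSr -!permX -(expg_mod _ (perm_expN p)).
Qed.

Lemma wordof_letter p x : letter (wordof p x) = b x.
Proof. by rewrite /letter ffunE. Qed.

Lemma wordof_iter p j x : wordof p (iter j p x) = iter j (@shift N' k) (wordof p x).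
Proof. by elim: j => //= j <-; apply: wordof_shift. Qed.

Lemma wordof_unique p (V : 'I_m -> word N' k) :
    (forall x, V (p x) = shift (V x)) -> (forall x, letter (V x) = b x) ->
  V =1 wordof p.
Proof.
move=> Vs Vl x; apply: word_ext => j; rewrite -wordof_iter wordof_letter -Vl.
by congr letter; elim: j => //= j ->; rewrite Vs.
Qed.

(** [p] maps the points with word [u] bijectively onto those with word [shift u]. *)
Lemma mult_shift p u : mult p (shift u) = mult p u.
Proof.
rewrite /mult -(card_imset [set x | wordof p x == u] (@perm_inj _ p)).
apply: eq_card => x; rewrite inE; apply/eqP/imsetP => [wx|[y]]; last first.
  by rewrite inE => /eqP <- ->; rewrite wordof_shift.
exists (p^-1 x)%g; last by rewrite permKV.
by rewrite inE -(inj_eq (@shift_inj _ _)) -wordof_shift permKV wx.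
Qed.

Lemma mult_content p a : \sum_(u | letter u == a) mult p u = #|[set x | b x == a]|.
Proof.
rewrite -sum1_card (partition_big (wordof p) (fun u => letter u == a)) /=; last first.
  by move=> x; rewrite inE wordof_letter.
apply: eq_bigr => u /eqP ua; rewrite /mult -sum1_card; apply: eq_bigl => x.
by rewrite !inE -ua; case: eqP => [<-|]; rewrite ?wordof_letter ?eqxx ?andbF.
Qed.

Lemma mult_gt0 p x : 0 < mult p (wordof p x).
Proof. by apply/card_gt0P; exists x; rewrite inE. Qed.

(** When the first letters tie, the two points share a block, so [p] keeps or reverses their order
    just as [altlex] keeps or swaps its arguments. *)
Lemma wordof_mono e p : fiber_mono e b p -> label_mono (leW e) (wordof p).
Proof.
move=> pm; rewrite /leW => x y.
have ux z i : unroll (wordof p z) i = b (iter i p z).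
  by rewrite -[i]add0n -unroll_iter -wordof_iter unroll0 wordof_letter.
move=> xy; rewrite (altlex_ext _ _ (ux x) (ux y)).
elim: N x y xy => // l IH x y xy; rewrite altlexS.
have shiftE z : (fun i => nat_of_ord (b (iter i p z))) \o S =1
                 fun i => nat_of_ord (b (iter i p (p z))).
  by move=> i /=; rewrite -iterSr.
case: ltngtP (b_mono xy) => //= /ord_inj bxy _.
have := pm _ _ bxy xy; case: (e) IH => IH pxy;
  by rewrite (altlex_ext _ _ (shiftE _) (shiftE _)); apply: IH.
Qed.

Lemma fiber_mono_word e p (V : 'I_m -> word N' k) :
  (forall x, letter (V x) = b x) -> fiber_mono e b p -> fiber_mono e V p.
Proof. by move=> Vl pm x y Vxy; apply: pm; rewrite -!Vl Vxy. Qed.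

(** Words are sorted along the positions, so multiplicities determine them all; then [p] is the
    unique monotone matching of the fibers of [shift \o wordof p] with those of [wordof p]. *)
Lemma mult_inj e p q :
  fiber_mono e b p -> fiber_mono e b q -> mult p =1 mult q -> p = q.
Proof.
move=> pm qm pq.
have W : wordof p =1 wordof q.
  by apply: (@label_mono_uniq _ _ _ (@leW_trans _ _ e) (@leW_anti _ _ e) (wordof p) (wordof q));
    try exact: wordof_mono.
have fm (r : {perm 'I_m}) : fiber_mono e b r -> fiber_mono e (@shift N' k \o wordof r) r.
  move=> rm x y /shift_inj; apply: fiber_mono_word (rm) _ _ => z.
  exact: wordof_letter.
apply: (@fiber_match_uniq _ _ e (@shift N' k \o wordof p) (wordof p)).
- exact: wordof_shift.
- by move=> x; rewrite /= !W wordof_shift.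
- exact: fm.
- by move=> x y /=; rewrite !W; apply: (fm q qm).
Qed.

(** Lay out the words of [M] in sorted order as [V]. The content forces their first letters to be
    [b], and [p] comes from matching the fibers of [shift \o V] with those of [V]. *)
Lemma mult_surj e (M : word N' k -> nat) :
    (forall u, M (shift u) = M u) ->
    (forall a, \sum_(u | letter u == a) M u = #|[set x | b x == a]|) ->
  exists p, fiber_mono e b p /\ mult p =1 M.
Proof.
move=> Ms Mc.
have [|V [Vm VM]] := @label_mono_exists m _ _ (@leW_total _ _ e) (@leW_trans N' k e) M.
  rewrite (partition_big (@letter N' k) predT) //= (eq_bigr _ (fun a _ => Mc a)).
  rewrite -[RHS]card_ord -sum1_card (partition_big b predT) //=.
  by apply: eq_bigr => a _; rewrite -sum1_card; apply: eq_bigl => x; rewrite inE.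
have Vl x : letter (V x) = b x.
  apply: (@label_mono_uniq _ _ (fun i j : 'I_k => i <= j) _ _ (@letter _ _ \o V) b) => //.
  - by move=> i j l; apply: leq_trans.
  - by move=> i j; rewrite -eqn_leq => /eqP/ord_inj.
  - by move=> y z yz; apply: leW_letter (Vm _ _ yz).
  move=> a; rewrite -Mc -sum1_card (partition_big V (fun u => letter u == a)) /=.
    apply: eq_bigr => u /eqP ua; rewrite -VM -sum1_card; apply: eq_bigl => y.
    by rewrite !inE -ua; case: (V y =P u) => [->|]; rewrite ?eqxx ?andbF.
  by move=> y; rewrite inE.
have [u|p [pV pm]] := @fiber_match m _ e (@shift N' k \o V) V.
  have [v ->] : exists v, u = shift v.
    by exists ((shiftp N' k)^-1 u)%g; rewrite -{1}(permKV (shiftp N' k) u) permE.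
  by rewrite [RHS]VM Ms -VM; apply: eq_card => x; rewrite !inE /= (inj_eq (@shift_inj _ _)).
have {}pV z : V (p z) = shift (V z) by rewrite pV.
exists p; split; last first.
  by move=> u; rewrite -VM; apply: eq_card => x; rewrite !inE (wordof_unique pV Vl).
move=> x y bxy xy; have Vxy := Vm _ _ xy.
have [VE|VN] := eqVneq (V x) (V y); first by apply: pm => //=; rewrite VE.
have pN : p x != p y.
  by rewrite (inj_eq perm_inj); apply: contra VN => /eqP ->.
(* If [p x] and [p y] were in the wrong order, sortedness of [V] and [leW_shift] would give
   inequalities both ways between their words, forcing [V x = V y]. *)
case/orP: (ltx_total e pN) => // pyx.
case/eqP: VN; apply: (@shift_inj N' k); rewrite -!pV; apply: (@leW_anti _ _ e).
move: Vxy; rewrite leW_shift ?Vl // -!pV.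
by case: e pyx Vm {pm} => pyx Vm ->; rewrite ?andbT ?andTb; apply: Vm.
Qed.

End GesselReutenauer.

(** * Cycle lengths and periods of words *)

Section Cycles.
Variables (N' k m : nat) (b : 'I_m -> 'I_k).
Local Notation N := N'.+1.
Hypothesis mN : m`! %| N.
Implicit Types (p q : {perm 'I_m}) (u v : word N' k) (e : bool).
Local Notation wordof := (@wordof N' k m b).
Local Notation mult := (@mult N' k m b).

(** The minimal period of [u]. *)
Definition per u := #|porbit (shiftp N' k) u|.

Lemma per_dvdP u j : (iter j (@shift N' k) u == u) = (per u %| j).
Proof.
rewrite -perm_dvd_porbit permX; congr (_ == _).
by elim: j => //= j ->; rewrite permE.
Qed.

Lemma per_eq1 u : (per u == 1) = (shift u == u).
Proof. by rewrite -dvdn1 -per_dvdP. Qed.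

Lemma per_dvd_porbit p x : per (wordof p x) %| #|porbit p x|.
Proof. by rewrite -per_dvdP -wordof_iter // iter_porbit. Qed.

(** Equal words keep the two points in a common block at every step, and a decreasing map reverses
    their order each time. *)
Lemma iter_fiber_mono e p : fiber_mono e b p -> forall j x y,
  wordof p x = wordof p y -> x < y -> ltx (e && odd j) (iter j p x) (iter j p y).
Proof.
move=> pm j x y wxy xy; elim: j => [|j IH]; first by rewrite andbF.
have W : wordof p (iter j p x) = wordof p (iter j p y) by rewrite !wordof_iter // wxy.
have := congr1 (@letter _ _) W; rewrite !wordof_letter => bj.
have := @pm (iter j p x) (iter j p y) bj; have := pm _ _ (esym bj).
by rewrite /=; case: (e) IH => //=; case: (odd j) => //= lt h1 h2; auto.
Qed.

(** [p ^+ j] preserves the set of points sharing the word of [x] and is increasing there, so it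
    fixes them. *)
Lemma fiber_fix e p x j : fiber_mono e b p ->
  per (wordof p x) %| j -> ~~ (e && odd j) -> #|porbit p x| %| j.
Proof.
move=> pm dj ej; rewrite -perm_dvd_porbit; apply/eqP.
apply: (@incr_perm_fix _ _ [set y | wordof p y == wordof p x]); rewrite ?inE // => y.
  by rewrite !inE permX wordof_iter // => /eqP ->; rewrite per_dvdP.
move=> z; rewrite !inE !permX => /eqP Wy /eqP Wz yz.
have := iter_fiber_mono pm j (etrans Wy (esym Wz)) yz.
by rewrite (negbTE ej).
Qed.

Lemma porbit_inc p x : fiber_mono false b p -> #|porbit p x| = per (wordof p x).
Proof.
move=> pm; apply/eqP; rewrite eqn_dvd per_dvd_porbit andbT.
exact: fiber_fix pm _ _.
Qed.

(** The cycle length is a multiple of the period [d]; it equals [d] when [d] is even and divides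
    [2d] when [d] is odd. *)
Lemma odd_porbit_dec p x : fiber_mono true b p ->
  odd #|porbit p x| =
  odd (per (wordof p x)) && (iter (per (wordof p x)) p x == x).
Proof.
move=> pm; set d := per _; have dc : d %| #|porbit p x| := per_dvd_porbit p x.
rewrite -permX perm_dvd_porbit; case: (boolP (odd d)) => od /=; last first.
  suff -> : #|porbit p x| = d by apply: negbTE.
  by apply/eqP; rewrite eqn_dvd dc (fiber_fix pm) ?dvdnn.
have c2 : #|porbit p x| %| d * 2.
  by apply: (fiber_fix pm); rewrite ?dvdn_mulr // oddM andbF.
apply/idP/idP => [oc|cd]; first by rewrite -(@Gauss_dvdl _ _ 2) // coprimen2.
by have -> : #|porbit p x| = d by apply/eqP; rewrite eqn_dvd cd.
Qed.

Lemma card_odd_fiber p u : fiber_mono true b p -> odd (per u) ->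
  #|[set x | (wordof p x == u) && odd #|porbit p x|]| = odd (mult p u).
Proof.
move=> pm ou; set F := [set x | _].
pose d := per u; pose f := (p ^+ d)%g.
pose S := [set x | wordof p x == u].
(* As [d] is odd, a point of [S] lies on an odd cycle exactly when the first return map [f] fixes
   it. *)
have FE : F = [set x in S | f x == x].
  apply/setP => x; rewrite !inE odd_porbit_dec // permX.
  by case: (wordof p x =P u) => //= ->; rewrite ou.
have fS x : x \in S -> f x \in S.
  by rewrite !inE permX wordof_iter // => /eqP ->; rewrite per_dvdP.
have fm x y : x \in S -> y \in S -> x < y -> f y < f x.
  rewrite !inE /f !permX => /eqP Wx /eqP Wy xy.
  by have := iter_fiber_mono pm d (etrans Wx (esym Wy)) xy; rewrite ou.
have ff x : x \in S -> f (f x) = x.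
  rewrite inE => /eqP Wx; apply/eqP; rewrite -permM -expgD addnn perm_dvd_porbit.
  by apply: (fiber_fix pm); rewrite ?Wx ?odd_double ?andbF // -muln2 dvdn_mulr.
have F1 : #|F| <= 1.
  apply/card_le1_eqP => x y; rewrite FE !inE => /andP[xS /eqP fx] /andP[yS /eqP fy].
  have [/ord_inj //|] := eqVneq (x : nat) y.
  rewrite neq_ltn => /orP[] lt; [have := fm x y|have := fm y x];
    by rewrite !inE fx fy xS yS => /(_ isT isT lt); rewrite ltnNge ltnW.
(* [f] is an order-reversing involution of [S], so it has at most one fixed point. *)
pose Lt := [set x in S | x < f x]; pose Gt := [set x in S | f x < x].
have GtE : Gt = [set f x | x in Lt].
  apply/setP => x; apply/idP/imsetP => [|[y]]; rewrite !inE => /andP[].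
    move=> xS lt; exists (f x); last by rewrite ff // inE.
    by rewrite inE fS ?inE ?ff ?xS // inE.
  move=> yS lt ->; have := fS y; rewrite !inE => -> //.
  by rewrite ff // inE.
(* [f] exchanges [Lt] and [Gt], so the points it moves are even in number. *)
have cS : #|S| = #|F| + #|Lt| + #|Lt|.
  have := card_imset Lt (@perm_inj _ f); rewrite -GtE => {2}<-.
  rewrite -(cardsID F S) -addnA; congr (_ + _).
    by apply: eq_card => x; rewrite FE !inE; case: (wordof p x == u).
  rewrite -(cardsID Lt (S :\: F)); congr (_ + _); apply: eq_card => x; rewrite FE !inE.
    by case: (wordof p x == u); rewrite ?andbF //= -(inj_eq (@ord_inj _)); case: ltngtP.
  by case: (wordof p x == u); rewrite ?andbF //= -(inj_eq (@ord_inj _)); case: ltngtP.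
rewrite /mult cS -addnA addnn oddD odd_double addbF.
by case: #|F| F1 => [|[|]].
Qed.

(** A fixed point has a shift-invariant word, and for such a word the odd cycles counted by
    [card_odd_fiber] are fixed points. *)
Lemma card_fix_dec p : fiber_mono true b p ->
  #|[set x | p x == x]| = #|[set u : word N' k | (shift u == u) && odd (mult p u)]|.
Proof.
move=> pm; rewrite -sum1_card (partition_big (wordof p) (fun u => shift u == u)) /=.
  rewrite -[RHS]sum1_card [RHS](eq_bigl (fun u => (shift u == u) && odd (mult p u))); last first.
    by move=> u; rewrite inE.
  rewrite [RHS]big_mkcondr; apply: eq_bigr => u su /=.
  have d1 : per u = 1 by apply/eqP; rewrite per_eq1.
  rewrite -[RHS]/(nat_of_bool _) -card_odd_fiber ?d1 // -sum1_card; apply: eq_bigl => x.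
  rewrite !inE andbC; case: (wordof p x =P u) => //= Wx.
  by rewrite odd_porbit_dec // Wx d1.
by move=> x; rewrite inE -wordof_shift // => /eqP ->.
Qed.

Lemma OC_inc p : fiber_mono false b p ->
  [forall x, odd #|porbit p x|] = [forall u, ~~ odd (per u) ==> (mult p u == 0)].
Proof.
move=> pm; apply/forallP/forallP => [h u|h x].
  apply/implyP => ou; rewrite cards_eq0; apply/eqP/setP => x; rewrite !inE.
  by apply: contraNF ou => /eqP <-; rewrite -porbit_inc.
have := h (wordof p x); rewrite porbit_inc //; case: odd => //=.
by rewrite eqn0Ngt mult_gt0.
Qed.

Lemma odd_mult_exists p u : fiber_mono true b p -> odd (per u) ->
  odd (mult p u) = [exists x, (wordof p x == u) && odd #|porbit p x|].
Proof.
move=> pm ou; have := card_odd_fiber pm ou; case: odd => /= h.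
  have /card_gt0P[x] : 0 < #|[set x | (wordof p x == u) && odd #|porbit p x| ]| by rewrite h.
  by rewrite inE => hx; apply/esym/existsP; exists x.
apply/esym/existsP => -[x hx]; have := card0_eq h x; by rewrite inE hx.
Qed.

Lemma odd_per_dec p x : fiber_mono true b p -> odd #|porbit p x| ->
  odd (per (wordof p x)) && odd (mult p (wordof p x)).
Proof.
move=> pm ox; have := ox; rewrite odd_porbit_dec // => /andP[ou _].
by rewrite ou odd_mult_exists //; apply/existsP; exists x; rewrite eqxx.
Qed.

Lemma EC_even_dec p : fiber_mono true b p ->
  [forall x, ~~ odd #|porbit p x|] = [forall u, odd (per u) ==> ~~ odd (mult p u)].
Proof.
move=> pm; apply/forallP/forallP => [h u|h x].
  apply/implyP => ou; rewrite odd_mult_exists //; apply/existsP => -[x].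
  by rewrite (negbTE (h x)) andbF.
apply/negP => /(odd_per_dec pm)/andP[ou om].
by have := h (wordof p x); rewrite ou om.
Qed.

(** An odd cycle is as long as the period of its word, so the fixed points are the odd cycles with
    shift-invariant words. *)
Lemma EC_odd_dec p : fiber_mono true b p ->
  [forall x, (#|porbit p x| != 1) ==> ~~ odd #|porbit p x|] =
  [forall u, (shift u != u) && odd (per u) ==> ~~ odd (mult p u)].
Proof.
move=> pm; apply/forallP/forallP => [h u|h x].
  apply/implyP => /andP[su ou]; rewrite odd_mult_exists //.
  apply/existsP => -[x /andP[/eqP Wx ox]]; have := h x; rewrite ox implybF negbK.
  by apply/negP; apply: contra su => /eqP c1; have := per_dvd_porbit p x;
    rewrite Wx c1 dvdn1 per_eq1.
apply/implyP; apply: contra => ox; have /andP[ou om] := odd_per_dec pm ox.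
have := h (wordof p x); rewrite ou om andbT implybF negbK -per_eq1 => /eqP d1.
by move: ox; rewrite odd_porbit_dec // d1 -permX perm_dvd_porbit /= dvdn1.
Qed.

End Cycles.

(** * Counting multisets of necklaces by content *)

Section NecklaceCount.
Variables (P K : finType) (c : P -> K -> nat) (n : nat).
(** [P] stands for the necklaces, [K] for the letters and [c p a] for the number of letters [a] in
    [p]; the weight is then the length. *)
Definition weight p := \sum_a c p a.
Local Notation s := weight.
Hypothesis s_gt0 : forall p, 0 < s p.
Local Notation T := {ffun P -> 'I_n.+1}.
Implicit Types (M D : T) (al : K -> nat).

Definition cont M a := \sum_p M p * c p a.
(* [n] bounds the multiplicities: it is at least the total size of every
   content [al] for which [mset al] is used. *)
Definition mset al : {set T} := [set M | [forall a, cont M a == al a]].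
(** This is the multiset form of [EC] for even [n], with generating function A; [odd_supp] is that
    of [OC], with generating function O. *)
Definition even_on_odd M := [forall p, odd (s p) ==> ~~ odd (M p)].
Definition odd_supp M := [forall p, ~~ odd (s p) ==> (M p == 0 :> nat)].
Definition add_mset M D : T := [ffun p => inord (M p + D p)].
Definition sub_mset M D : T := [ffun p => inord (M p - D p)].
Definition leM D M := [forall p, D p <= M p].

Lemma eq_mset al be : al =1 be -> mset al = mset be.
Proof. by move=> E; apply/setP => M; rewrite !inE; apply: eq_forallb => a; rewrite E. Qed.

Lemma sum_cont M : \sum_a cont M a = \sum_p M p * s p.
Proof. by rewrite exchange_big /=; apply: eq_bigr => p _; rewrite big_distrr. Qed.

Lemma msetP al M : reflect (cont M =1 al) (M \in mset al).
Proof. by rewrite inE; apply: (iffP forallP) => h a; apply/eqP; rewrite ?h. Qed.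

Lemma weight_bound (g : P -> nat) p : \sum_p g p * s p <= n -> g p < n.+1.
Proof.
rewrite ltnS (bigD1 p) //=; apply: leq_trans; apply: leq_trans (leq_addr _ _).
by rewrite -[X in X <= _]muln1 leq_mul.
Qed.

(** Weights are positive, so no multiplicity exceeds the total content, which is at most [n], and
    [inord] does not truncate. *)
Lemma add_msetE D al M p :
    (forall a, cont D a <= al a) -> \sum_a al a <= n ->
  M \in mset (fun a => al a - cont D a) -> add_mset M D p = M p + D p :> nat.
Proof.
move=> Da aln /msetP Mc; rewrite ffunE inordK //.
apply: (@weight_bound (fun p => M p + D p)).
apply: leq_trans aln; rewrite (eq_bigr _ (fun p _ => mulnDl _ _ _)) big_split /= -!sum_cont.
by rewrite -big_split leq_sum // => a _; rewrite Mc /= subnK.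
Qed.

(** Adding [D] is a bijection, with inverse the subtraction of [D]. *)
Lemma card_mset_shift D (Q : pred T) al :
    (forall a, cont D a <= al a) -> \sum_a al a <= n ->
  #|[set M in mset al | leM D M && Q M]| =
  #|[set M in mset (fun a => al a - cont D a) | Q (add_mset M D)]|.
Proof.
move=> Da aln; have addK M := fun Mc p => @add_msetE D al M p Da aln Mc.
rewrite -[RHS](card_in_imset (f := fun M => add_mset M D)); last first.
  move=> M M' /setIdP[Mc _] /setIdP[Mc' _] E.
  apply/ffunP => p; apply: ord_inj; apply: (@addIn (D p)).
  by rewrite /= -(addK _ Mc) -(addK _ Mc') [add_mset M D]E.
apply: eq_card => M; apply/idP/imsetP => [|[M']]; rewrite !inE; last first.
  move=> /andP[Mc QM] ->; rewrite QM andbT; have Mc' := addK M'; rewrite inE in Mc'.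
  apply/andP; split; apply/forallP => x; last by rewrite Mc' // leq_addl.
  rewrite /cont (eq_bigr (fun p => M' p * c p x + D p * c p x)).
    by rewrite big_split /= -!/(cont _ _) (eqP (forallP Mc x)) subnK.
  by move=> p _; rewrite Mc' // mulnDl.
move=> /and3P[Mc DM QM]; have subE p : sub_mset M D p = M p - D p :> nat.
  by rewrite ffunE inordK // ltnS (leq_trans (leq_subr _ _)) // -ltnS.
have E : M = add_mset (sub_mset M D) D.
  apply/ffunP => p; apply: ord_inj; rewrite ffunE subE subnK ?(forallP DM) //.
  by rewrite inordK.
exists (sub_mset M D) => //; rewrite !inE -E QM andbT; apply/forallP => a.
rewrite -(eqP (forallP Mc a)) -sumnB; last first.
  by move=> p _; rewrite leq_mul2r (forallP DM) orbT.
by apply/eqP; apply: eq_bigr => p _; rewrite subE mulnBl.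
Qed.

Lemma card_mset_above D al : \sum_a al a <= n ->
  #|[set M in mset al | leM D M]| =
  if [forall a, cont D a <= al a] then #|mset (fun a => al a - cont D a)| else 0.
Proof.
move=> aln; case: (boolP [forall a, _]) => [/forallP Da|].
  have := card_mset_shift predT Da aln.
  have -> : [set M in mset al | leM D M && predT M] = [set M in mset al | leM D M].
    by apply/setP => M; rewrite !inE andbT.
  by move=> ->; apply: eq_card => M; rewrite !inE andbT.
rewrite negb_forall => /existsP[a Na]; apply: eq_card0 => M; rewrite !inE.
apply/negP => /andP[/forallP/(_ a)/eqP Mc /forallP DM]; case/negP: Na.
by rewrite -Mc leq_sum // => p _; rewrite leq_mul2r DM orbT.
Qed.

(** * Signed enumeration of multisets *)

Import GRing.Theory Num.Theory.
Local Open Scope ring_scope.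

(** On [odd_supp] multisets this is the sign in O(-x), since the number of odd necklaces has the
    parity of the total size. *)
Definition sgnM M : int := (-1) ^+ (\sum_p M p)%N.

Lemma sum_signs m : \sum_(j < n.+1 | (j <= m)%N) (-1) ^+ j = (~~ odd (minn m n))%:R :> int.
Proof.
have -> : \sum_(j < n.+1 | (j <= m)%N) (-1) ^+ j = \sum_(j < (minn m n).+1) (-1) ^+ j :> int.
  rewrite (big_ord_widen n.+1 (fun j => (-1) ^+ j)) ?ltnS ?geq_minr //.
  by apply: eq_bigl => j; rewrite ltnS leq_min -[(j <= n)%N]ltnS ltn_ord andbT.
elim: (minn m n) => [|l IH]; first by rewrite big_ord1.
by rewrite big_ord_recr IH -signr_odd /=; case: odd.
Qed.

(* The sign-counting behind [O(x) * O(-x) = prod 1 / (1 - w ^ 2)]. *)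
Lemma sum_sgn_below M :
  \sum_(D | odd_supp D && leM D M) sgnM D = (even_on_odd M)%:R.
Proof.
(* The sum factors over the necklaces: an odd one contributes an alternating sum, which is 1 or 0 as
   [M p] is even or odd; an even one forces [D p = 0]. *)
pose Q p := [pred j : 'I_n.+1 | (~~ odd (s p) ==> (j == 0%N :> nat)) && (j <= M p)%N].
rewrite (eq_bigl (fun D : T => D \in family Q)); last first.
  move=> D; rewrite -[RHS]/[forall p, Q p (D p)] /=.
  apply/andP/forallP => [[/forallP h1 /forallP h2] p|h]; first by rewrite h1 h2.
  by split; apply/forallP => p; have /andP[hp hp'] := h p.
rewrite (eq_bigr (fun D : T => \prod_p (-1) ^+ (D p))); last by move=> D _; rewrite prodrXr.
rewrite -(bigA_distr_big_dep Q (fun _ j => (-1) ^+ j)).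
rewrite (eq_bigr (fun p => (odd (s p) ==> ~~ odd (M p))%:R)); last first.
  move=> p _; case: (boolP (odd (s p))) => op /=.
    rewrite (eq_bigl (fun j : 'I_n.+1 => (j <= M p)%N)); last by move=> j; rewrite /Q /= op.
    by rewrite sum_signs (minn_idPl _) // -ltnS.
  rewrite (big_pred1 ord0) // => j; rewrite /Q /= op /= -(inj_eq (@ord_inj _)).
  by case: (nat_of_ord j).
rewrite /even_on_odd; case: forallP => [h|/forallP]; first by rewrite big1 // => p _; rewrite h.
rewrite negb_forall => /existsP[p hp].
by rewrite (bigD1 p) //= (negbTE hp) mul0r.
Qed.

(** The coefficient form of A = E * O(x) * O(-x): expand the indicator into signs and exchange the
    sums. *)
Lemma card_even_on_odd al : (\sum_a al a <= n)%N ->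
  (#|[set M in mset al | even_on_odd M]|)%:R =
  \sum_(D | odd_supp D && [forall a, (cont D a <= al a)%N])
     sgnM D * (#|mset (fun a => al a - cont D a)%N|)%:R.
Proof.
move=> aln; rewrite -sum1_card natr_sum (eq_bigl _ _ (fun M => in_set _ _)).
rewrite big_mkcondr /=.
rewrite (eq_bigr (fun M => \sum_(D | odd_supp D && leM D M) sgnM D)); last first.
  by move=> M _; rewrite sum_sgn_below; case: even_on_odd.
rewrite (exchange_big_dep odd_supp) /=; last by move=> M D _ /andP[].
rewrite [RHS]big_mkcondr; apply: eq_bigr => D oD.
rewrite sumr_const.
rewrite (_ : #|_| = #|[set M in mset al | leM D M]|); last first.
  by apply: eq_card => M; rewrite [LHS]unfold_in [RHS]in_set oD.
by rewrite card_mset_above //; case: ifP; rewrite ?mulr0n // mulr_natr.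
Qed.

Definition lower al (a : K) : K -> nat := fun x => (al x - (x == a))%N.

Lemma sum_lower al a : (0 < al a)%N -> (\sum_x al x = (\sum_x lower al a x).+1)%N.
Proof.
move=> a0; rewrite !(bigD1 a (P := predT)) //= -addSn /lower eqxx subn1 prednK //; congr addn.
by apply: eq_bigr => i /negbTE ->; rewrite subn0.
Qed.

(* The coefficient form of [E * O * (1 - p_1) = 1]. *)
Hypothesis mset_rec : forall al, (\sum_a al a <= n)%N ->
  #|mset al| = ([forall a, al a == 0] + \sum_(a | 0 < al a) #|mset (lower al a)|)%N.

Lemma odd_supp_card D : odd_supp D -> odd (\sum_p D p) = odd (\sum_a cont D a).
Proof.
move=> /forallP oD; rewrite sum_cont.
elim/big_rec2: _ => // p x y _; rewrite !oddD oddM => ->; congr (_ (+) _).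
by have := oD p; case: (odd (s p)) => /=; rewrite ?andbT // => /eqP ->.
Qed.

(* The coefficient form of [A * (1 - p_1) = O(-x)]. *)
Lemma even_on_odd_rec al : (\sum_a al a <= n)%N ->
  (#|[set M in mset al | even_on_odd M]|)%:R =
  (-1) ^+ (\sum_a al a)%N * (#|[set M in mset al | odd_supp M]|)%:R +
  (\sum_(a | (0 < al a)%N) #|[set M in mset (lower al a) | even_on_odd M]|)%:R :> int.
Proof.
move=> aln; have lown a : (0 < al a)%N -> (\sum_x lower al a x <= n)%N.
  by move=> a0; apply: leq_trans aln; rewrite (sum_lower a0).
rewrite card_even_on_odd // natr_sum.
rewrite [X in _ = _ + X](eq_bigr _ (fun a a0 => card_even_on_odd (lown a a0))).
rewrite (exchange_big_dep (fun D => odd_supp D && [forall a, (cont D a <= al a)%N])) /=; last first.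
  move=> a D _ /andP[-> /forallP h]; apply/forallP => x.
  by apply: leq_trans (h x) _; apply: leq_subr.
(* The recursion is applied to [al] minus the content of [D]. Its constant term survives only when
   [D] has content [al]; the other terms match the expansions for the lowered contents. *)
rewrite (eq_bigr (fun D => sgnM D * [forall a, al a - cont D a == 0]%N%:R + sgnM D *
   (\sum_(a | (0 < al a - cont D a)%N) #|mset (lower (fun a => al a - cont D a)%N a)|)%:R)); last first.
  move=> D /andP[oD /forallP Da]; rewrite -mulrDr -natrD mset_rec //.
  by apply: leq_trans aln; rewrite leq_sum // => a _; apply: leq_subr.
rewrite big_split /=; congr (_ + _).
  rewrite -sum1_card natr_sum big_distrr /= big_mkcond [RHS]big_mkcond /=.
  apply: eq_bigr => D _; rewrite !inE andbC.
  case: (boolP (odd_supp D)) => oD; rewrite ?andbF //= andbT mulr1.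
  case: (boolP [forall a, cont D a == al a]) => [/forallP E|NE].
    have -> : [forall a, (cont D a <= al a)%N] by apply/forallP => a; rewrite (eqP (E a)).
    have -> : [forall a, (al a - cont D a)%N == 0%N].
      by apply/forallP => a; rewrite (eqP (E a)) subnn.
    rewrite mulr1 /sgnM -signr_odd odd_supp_card // signr_odd.
    by congr (_ ^+ _); apply: eq_bigr => a _; apply/eqP.
  case: forallP => // h; rewrite (_ : [forall a, _] = false) ?mulr0 //.
  apply: contraNF NE => /forallP h'; apply/forallP => a.
  by rewrite eqn_leq h -subn_eq0 h'.
apply: eq_bigr => D /andP[oD /forallP Da]; rewrite natr_sum big_distrr /=.
(* Removing a letter commutes with removing [D], and both index conditions say that [a] still occurs
   once [D] is removed. *)
apply: eq_big => [a|a a0]; last first.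
  congr (_ * _%:R); apply: eq_card; apply/setP; apply: eq_mset => x; rewrite /lower.
  by rewrite -!subnDA addnC.
rewrite oD subn_gt0; apply/idP/andP => [lt|[a0 /forallP/(_ a)]]; last first.
  by rewrite /lower eqxx subn1 -ltnS prednK.
split; first exact: leq_ltn_trans lt.
apply/forallP => x; rewrite /lower; case: (x =P a) => [->|_]; last by rewrite subn0.
by rewrite subn1 -ltnS prednK // (leq_ltn_trans _ lt).
Qed.

Local Close Scope ring_scope.

(** In each product [M p * s p] at least one factor is even. *)
Lemma even_on_odd_card M : even_on_odd M -> ~~ odd (\sum_a cont M a).
Proof.
move=> /forallP eM; rewrite sum_cont; elim/big_rec: _ => // p x _ ox.
by rewrite oddD (negbTE ox) addbF oddM andbC; have := eM p; case: odd.
Qed.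

Lemma card_even_on_odd_eq0 al : odd (\sum_a al a) ->
  #|[set M in mset al | even_on_odd M]| = 0.
Proof.
move=> oa; apply: eq_card0 => M; apply/negP => /setIdP[/msetP Mc /even_on_odd_card].
by rewrite (eq_bigr _ (fun a _ => Mc a)) oa.
Qed.

(** In [even_on_odd_rec] the lowered contents have odd total and contribute 0, and the sign is 1. *)
Lemma card_even_on_odd_even al : \sum_a al a <= n -> ~~ odd (\sum_a al a) ->
  #|[set M in mset al | even_on_odd M]| = #|[set M in mset al | odd_supp M]|.
Proof.
move=> aln ea; have := even_on_odd_rec aln.
rewrite [X in (_ + X%:R)%R]big1 => [|a a0]; last first.
  by apply: card_even_on_odd_eq0; move: ea; rewrite (sum_lower a0) negbK.
rewrite -signr_odd (negbTE ea) mul1r addr0 => /eqP.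
by rewrite eqr_nat => /eqP.
Qed.

(** In odd degree the left side of [even_on_odd_rec] is 0 and the sign is -1. *)
Lemma card_odd_supp_odd al : \sum_a al a <= n -> odd (\sum_a al a) ->
  #|[set M in mset al | odd_supp M]| =
  \sum_(a | 0 < al a) #|[set M in mset (lower al a) | even_on_odd M]|.
Proof.
move=> aln oa; have := even_on_odd_rec aln.
rewrite card_even_on_odd_eq0 // -signr_odd oa mulN1r => /esym/eqP.
by rewrite addrC subr_eq0 eqr_nat => /eqP ->.
Qed.

(** * Multisets with exactly one odd loop *)

Variable loop : K -> P.
Hypothesis cont_loop : forall a x, c (loop a) x = (x == a).
Hypothesis weight1 : forall p, (s p == 1) = (p \in codom loop).

(** The multiset form of [EC] for odd [n]: the necklace of length one with odd multiplicity accounts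
    for the fixed point. *)
Definition one_odd_loop M :=
  (#|[set p | (s p == 1) && odd (M p)]| == 1) &&
  [forall p, (s p != 1) && odd (s p) ==> ~~ odd (M p)].

Definition only_odd_loop a M :=
  odd (M (loop a)) && [forall p, (p != loop a) && odd (s p) ==> ~~ odd (M p)].

Lemma weight_loop a : s (loop a) = 1.
Proof. by apply/eqP; rewrite weight1 codom_f. Qed.

Lemma loop_inj : injective loop.
Proof. by move=> a a' E; have := cont_loop a a; rewrite E cont_loop eqxx; case: eqP. Qed.

Lemma one_odd_loopE M : one_odd_loop M = \sum_a only_odd_loop a M :> nat.
Proof.
case: (boolP (one_odd_loop M)) => [/andP[/cards1P[p pE] /forallP eM]|NM].
  have := set11 p; rewrite -pE inE weight1 => /andP[/codomP[a pa] oM].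
  have even_p q : q != p -> odd (s q) -> ~~ odd (M q).
    move=> qp oq; have := eM q; rewrite oq andbT; case: eqP => // s1 _.
    have : q \notin [set p] by rewrite inE.
    by rewrite -pE inE s1.
  rewrite (bigD1 a) //= big1 ?addn0 => [|a' a'a].
    rewrite /only_odd_loop -pa oM /=; case: forallP => // -[] q.
    by apply/implyP => /andP[qp oq]; apply: even_p.
  rewrite /only_odd_loop (negbTE (even_p _ _ _)) //; last by rewrite weight_loop.
  by rewrite pa (inj_eq loop_inj).
rewrite big1 // => a _; case: (boolP (only_odd_loop a M)) => // /andP[oM /forallP eM].
case/negP: NM; apply/andP; split.
  apply/cards1P; exists (loop a); apply/setP => p; rewrite !inE.
  apply/andP/eqP => [[/eqP s1 op]|->]; last by rewrite weight_loop.
  by apply/eqP; apply: contraLR op => pa; have := eM p; rewrite pa s1.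
apply/forallP => p; apply/implyP => /andP[s1 op]; apply: implyP (eM p) _.
by rewrite op andbT; apply: contra s1 => /eqP ->; rewrite weight_loop.
Qed.

(** Removing one copy of [loop a] makes its multiplicity even and lowers the content by the letter
    [a]. *)
Lemma card_only_odd_loop al a : \sum_x al x <= n -> 0 < al a ->
  #|[set M in mset al | only_odd_loop a M]| =
  #|[set M in mset (lower al a) | even_on_odd M]|.
Proof.
move=> aln a0; have n0 : 0 < n.
  by apply: leq_trans aln; rewrite (sum_lower a0).
pose D : T := [ffun p => inord (p == loop a)].
have Dp p : D p = (p == loop a) :> nat by rewrite ffunE inordK //; case: eqP.
have Dc x : cont D x = (x == a).
  rewrite /cont (bigD1 (loop a)) //= Dp eqxx mul1n cont_loop big1 ?addn0 // => p pa.
  by rewrite Dp (negbTE pa).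
have Da x : cont D x <= al x by rewrite Dc; case: eqP => // ->.
have := card_mset_shift (only_odd_loop a) Da aln.
have -> : [set M in mset al | leM D M && only_odd_loop a M] =
          [set M in mset al | only_odd_loop a M].
  apply/setP => M; rewrite [LHS]in_set [RHS]in_set; congr (_ && _).
  case: (boolP (only_odd_loop a M)) => [/andP[oM _]|_]; rewrite ?andbF ?andbT //.
  by apply/forallP => p; rewrite Dp; case: eqP => // ->; apply: odd_gt0.
move=> ->; rewrite (@eq_mset (lower al a) (fun x => al x - cont D x)); last first.
  by move=> x; rewrite Dc.
apply: eq_card => M; rewrite [LHS]in_set [RHS]in_set; case: (boolP (M \in _)) => //= Mc.
have addE p : add_mset M D p = M p + (p == loop a) :> nat.
  by rewrite (add_msetE _ Da aln Mc) Dp.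
rewrite /only_odd_loop addE eqxx addn1 /=; apply/andP/forallP => [[oM /forallP h] p|h].
  have := h p; rewrite addE; case: eqP => [->|_]; rewrite ?addn0 //= => _.
  by rewrite oM implybT.
split; first by have := h (loop a); rewrite weight_loop.
apply/forallP => p; rewrite addE; case: eqP => //= _; rewrite addn0; exact: h.
Qed.

Lemma card_one_odd_loop al : \sum_x al x <= n ->
  #|[set M in mset al | one_odd_loop M]| =
  \sum_(a | 0 < al a) #|[set M in mset (lower al a) | even_on_odd M]|.
Proof.
move=> aln; rewrite -sum1_card (eq_bigl _ _ (fun M => in_set _ _)) big_mkcondr /=.
rewrite (eq_bigr (fun M => \sum_a only_odd_loop a M)); last first.
  by move=> M _; rewrite -one_odd_loopE; case: one_odd_loop.
rewrite exchange_big /= [RHS]big_mkcond; apply: eq_bigr => a _.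
transitivity #|[set M in mset al | only_odd_loop a M]|.
  rewrite -sum1_card [RHS](eq_bigl _ _ (fun M => in_set _ _)) [RHS]big_mkcondr /=.
  by apply: eq_bigr => M _; case: only_odd_loop.
case: (posnP (al a)) => [a0|]; last exact: card_only_odd_loop.
(* Without the letter [a] in the content, [loop a] has multiplicity 0, which is not odd. *)
apply: eq_card0 => M; apply/negP => /setIdP[/msetP/(_ a)]; rewrite a0 => /eqP.
rewrite sum_nat_eq0 => /forallP/(_ (loop a)); rewrite cont_loop eqxx muln1 => /eqP M0.
by rewrite /only_odd_loop M0.
Qed.

Lemma card_one_odd_loop_odd al : \sum_a al a <= n -> odd (\sum_a al a) ->
  #|[set M in mset al | odd_supp M]| = #|[set M in mset al | one_odd_loop M]|.
Proof. by move=> aln oa; rewrite card_odd_supp_odd // card_one_odd_loop. Qed.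

End NecklaceCount.

(** * Multisets of necklaces and words *)

Definition fmono m (L : eqType) e (g : 'I_m -> L) (p : {perm 'I_m}) :=
  [forall x, forall y, (g x == g y) && (x < y) ==> ltx e (p x) (p y)].

Lemma fmonoP m (L : eqType) e (g : 'I_m -> L) (p : {perm 'I_m}) : reflect (fiber_mono e g p) (fmono e g p).
Proof.
apply: (iffP forallP) => [h x y /eqP gxy xy|h x].
  by apply: implyP (forallP (h x) y) _; rewrite gxy.
by apply/forallP => y; apply/implyP => /andP[/eqP gxy xy]; apply: h.
Qed.

Definition count_words k m (al : 'I_k -> nat) :=
  #|[set t : m.-tuple 'I_k | [forall a, count_mem a t == al a]]|.

Lemma count_words0 k (al : 'I_k -> nat) : count_words 0 al = [forall a, al a == 0].
Proof.
rewrite /count_words; case: forallP => h; last first.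
  by apply: eq_card0 => t; rewrite !inE tuple0; apply/forallP => h'; apply: h => a; rewrite -(eqP (h' a)).
apply/eqP/cards1P; exists [tuple]; apply/setP => t; rewrite !inE tuple0 eqxx.
by apply/forallP => a; rewrite eq_sym h.
Qed.

Lemma sum_tuple_cons (T : finType) m (f : m.+1.-tuple T -> nat) :
  \sum_t f t = \sum_a \sum_(t : m.-tuple T) f [tuple of a :: t].
Proof.
rewrite pair_big /= (reindex (fun at_ : T * m.-tuple T => [tuple of at_.1 :: at_.2])) //=.
exists (fun t => (thead t, [tuple of behead t])) => [[a t] _|t _] /=.
  by congr pair; apply: val_inj.
by rewrite -tuple_eta.
Qed.

(** Split by the first letter. *)
Lemma count_wordsS k m (al : 'I_k -> nat) :
  count_words m.+1 al = \sum_(a | 0 < al a) count_words m (lower al a).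
Proof.
rewrite /count_words -sum1_card (eq_bigl _ _ (fun t => in_set _ t)) big_mkcond.
rewrite sum_tuple_cons [RHS]big_mkcond.
apply: eq_bigr => a _; rewrite -big_mkcond /= sum1_card.
case: posnP => a0.
  apply: eq_card0 => t; rewrite unfold_in; apply/negP => /forallP/(_ a).
  by rewrite /= eqxx a0.
apply: eq_card => t; rewrite [LHS]unfold_in inE; apply: eq_forallb => x; rewrite /lower /=.
rewrite eq_sym [a == x]eq_sym; case: (x =P a) => [->|_]; last by rewrite subn0.
by rewrite subn1 -[in LHS](prednK a0) eqSS.
Qed.

(** Writing the label of [x] at place [p x] gives a word with the content of [b]; a permutation
    increasing on the blocks is recovered from it by fiber matching. *)
Lemma card_fmono_words k m (b : 'I_m -> 'I_k) :
  #|[set p : {perm 'I_m} | fmono false b p]| = count_words m (fun a => #|[set x | b x == a]|).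
Proof.
pose w (p : {perm 'I_m}) : m.-tuple 'I_k := [tuple b ((p^-1)%g i) | i < m].
have wE p x : tnth (w p) (p x) = b x by rewrite tnth_mktuple permK.
have cw (t : m.-tuple 'I_k) a : count_mem a t = #|[set i | tnth t i == a]|.
  by rewrite -count_codom_ord /codom /image_mem map_tnth_enum.
rewrite -(card_in_imset (f := w)) => [|p q]; last first.
  rewrite !inE => /fmonoP pm /fmonoP qm pq.
  by apply: (@fiber_match_uniq _ _ false b (tnth (w p))) => // x; rewrite pq.
apply: eq_card => t; rewrite inE; apply/imsetP/forallP => [[p _ ->] a|h].
  rewrite cw -(card_imset [set x | b x == a] (@perm_inj _ p)); apply/eqP/eq_card => i.
  rewrite inE; apply/eqP/imsetP => [<-|[x]]; last by rewrite inE => /eqP <- ->.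
  by exists ((p^-1)%g i); rewrite ?permKV // inE -(wE p) permKV.
have [|p [pt pm]] := @fiber_match m _ false b (tnth t).
  by move=> a; rewrite -cw (eqP (h a)).
exists p; first by rewrite inE; apply/fmonoP.
by apply: eq_from_tnth => i; rewrite -[i](permKV p) wE pt.
Qed.

Section Necklaces.
Variables (N' k n : nat).
Hypothesis nN : n`! %| N'.+1.
Local Notation W := (word N' k).
Implicit Types u : W.

(** An orbit has as many words as their minimal period, so each orbit is a primitive necklace. *)
Definition necklace := {C : {set W} | C \in porbits (shiftp N' k)}.
Lemma porbit_in_porbits u : porbit (shiftp N' k) u \in porbits (shiftp N' k).
Proof. exact: imset_f. Qed.

Definition neckl u : necklace := exist _ (porbit (shiftp N' k) u) (porbit_in_porbits u).

Lemma neckl_surj (C : necklace) : exists u, neckl u == C.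
Proof.
case: C => C hC; case/imsetP: (hC) => u _ Cu; exists u.
by rewrite -val_eqE /= -Cu.
Qed.

Definition rep (C : necklace) : W := xchoose (neckl_surj C).

Lemma repK C : neckl (rep C) = C.
Proof. exact/eqP/(xchooseP (neckl_surj C)). Qed.

Lemma mem_neckl u (C : necklace) : (u \in val C) = (neckl u == C).
Proof. by rewrite -(repK C) -val_eqE /= eq_porbit_mem porbit_sym. Qed.

Lemma neckl_shift u : neckl (shift u) = neckl u.
Proof.
apply/eqP; rewrite -mem_neckl /=.
by have := mem_porbit (shiftp N' k) 1 u; rewrite expg1 permE.
Qed.

Lemma neckl_inv (T : Type) (f : W -> T) : (forall u, f (shift u) = f u) ->
  forall u, f (rep (neckl u)) = f u.
Proof.
move=> fs u; have : rep (neckl u) \in val (neckl u) by rewrite mem_neckl repK.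
case/porbitP => j ->; elim: j => [|j IH]; first by rewrite expg0 perm1.
by rewrite expgSr permM permE fs.
Qed.

(** The words of an orbit correspond to the positions in one period, so this counts the occurrences
    of [a] in the necklace. *)
Definition ncontent (C : necklace) (a : 'I_k) := #|[set u in val C | letter u == a]|.

Lemma weight_ncontent C : weight ncontent C = #|val C|.
Proof.
rewrite -sum1_card (partition_big (@letter N' k) predT) //=; apply: eq_bigr => a _.
by rewrite /ncontent -sum1_card; apply: eq_bigl => u; rewrite inE.
Qed.

Lemma weight_neckl u : weight ncontent (neckl u) = per u.
Proof. exact: weight_ncontent. Qed.

Lemma weight_gt0 C : 0 < weight ncontent C.
Proof. by rewrite -(repK C) weight_neckl lt0n card_porbit_neq0. Qed.

Lemma sum_ncontent (f : W -> nat) a : (forall u, f (shift u) = f u) ->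
  \sum_(u | letter u == a) f u = \sum_C f (rep C) * ncontent C a.
Proof.
move=> fs; rewrite (partition_big neckl predT) //=; apply: eq_bigr => C _.
rewrite mulnC -sum_nat_const; apply: eq_big => [u|u /andP[_ /eqP <-]].
  by rewrite inE mem_neckl andbC.
by rewrite neckl_inv.
Qed.

Section Transfer.
Variables (m : nat) (b : 'I_m -> 'I_k).
Hypothesis b_mono : forall x y : 'I_m, x < y -> b x <= b y.
Hypothesis mn : m <= n.

Let mN : m`! %| N'.+1.
Proof. by apply: dvdn_trans nN; rewrite -(bin_fact mn) dvdn_mull // dvdn_mulr. Qed.

Definition mset_of (p : {perm 'I_m}) : {ffun necklace -> 'I_n.+1} :=
  [ffun C => inord (mult b p (rep C))].

Lemma mset_ofE p u : mset_of p (neckl u) = mult b p u :> nat.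
Proof.
rewrite ffunE (neckl_inv (mult_shift _ mN p)) inordK // ltnS; apply: leq_trans mn.
by rewrite -[X in _ <= X]card_ord max_card.
Qed.

(** The correspondence as a bijection [mset_of]: injective by [mult_inj], onto the given content by
    [mult_surj]. *)
Lemma card_perm_mset e (Q : pred {perm 'I_m}) (R : pred {ffun necklace -> 'I_n.+1}) :
    (forall p : {perm 'I_m}, fiber_mono e b p -> Q p = R (mset_of p)) ->
  #|[set p | fmono e b p && Q p]| =
  #|[set M in mset ncontent n (fun a => #|[set x | b x == a]|) | R M]|.
Proof.
move=> QR; rewrite -(card_in_imset (f := mset_of)) => [|p q]; last first.
  rewrite !inE => /andP[/fmonoP pm _] /andP[/fmonoP qm _] E.
  by apply: (mult_inj b_mono mN pm qm) => u; rewrite -!mset_ofE E.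
apply: eq_card => M; apply/imsetP/setIdP => [[p]|[/msetP Mc RM]].
  rewrite inE => /andP[/fmonoP pm Qp] ->; split; last by rewrite -QR.
  apply/msetP => a; rewrite -(mult_content N' b p) (sum_ncontent _ (mult_shift _ mN p)).
  by apply: eq_bigr => C _; rewrite -{1}(repK C) mset_ofE.
have [|a|p [pm pM]] := @mult_surj N' k m b b_mono mN e (fun u => M (neckl u)).
- by move=> u; rewrite neckl_shift.
- rewrite (@sum_ncontent (fun u => M (neckl u))) => [|u]; last by rewrite neckl_shift.
  by rewrite -Mc; apply: eq_bigr => C _; rewrite repK.
have E : M = mset_of p.
  by apply/ffunP => C; apply: ord_inj; rewrite -(repK C) mset_ofE pM.
by exists p => //; rewrite inE QR // -E RM andbT; apply/fmonoP.
Qed.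

End Transfer.
End Necklaces.

(** * Necklaces of length one *)

Section Loops.
Variables (N' k : nat).
Local Notation W := (word N' k).
Implicit Types u : W.

Definition const_word a : W := [ffun=> a].
Definition loop a : necklace N' k := neckl (const_word a).

Lemma letter_const a : letter (const_word a) = a.
Proof. by rewrite /letter ffunE. Qed.

Lemma shift_const a : shift (const_word a) = const_word a.
Proof. by apply/ffunP => i; rewrite !ffunE. Qed.

Lemma shift_fixE u : shift u = u -> u = const_word (letter u).
Proof.
move=> su; apply: word_ext => j; rewrite !iter_fix ?shift_const ?letter_const //.
Qed.

Lemma neckl_fixE u (C : necklace N' k) : shift u = u -> (u \in val C) = (val C == [set u]).
Proof.
move=> su; rewrite mem_neckl; apply/eqP/eqP => [<-|E]; last first.
  by apply/eqP; rewrite -mem_neckl E set11.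
apply/setP => v; rewrite inE /=; apply/porbitP/eqP => [[j ->]|->]; last first.
  by exists 0; rewrite expg0 perm1.
by rewrite permX iter_fix // permE.
Qed.

Lemma val_loop a : val (loop a) = [set const_word a].
Proof. by apply/eqP; rewrite -neckl_fixE ?shift_const // mem_neckl. Qed.

Lemma ncontent_loop a x : ncontent (loop a) x = (x == a).
Proof.
rewrite /ncontent val_loop; case: (x =P a) => [->|xa].
  by apply/eqP/cards1P; exists (const_word a); apply/setP => u; rewrite !inE;
     case: eqP => // ->; rewrite letter_const eqxx.
apply: eq_card0 => u; rewrite !inE; apply/negP => /andP[/eqP -> /eqP E].
by apply: xa; rewrite -E letter_const.
Qed.

Lemma weight1_loop C : (weight (@ncontent N' k) C == 1) = (C \in codom loop).
Proof.
apply/idP/codomP => [|[a ->]]; last by rewrite weight_neckl per_eq1 shift_const.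
rewrite -{1}(repK C) weight_neckl per_eq1 => /eqP su.
by exists (letter (rep C)); rewrite /loop -shift_fixE // repK.
Qed.

End Loops.

(** * The count for permutations monotone on blocks *)

Section Main.
Variables (N' k n : nat).
Hypothesis nN : n`! %| N'.+1.
Local Notation W := (word N' k).
Local Notation nc := (@ncontent N' k).

Lemma forall_neckl (R : pred (necklace N' k)) : [forall u, R (neckl u)] = [forall C, R C].
Proof.
by apply/forallP/forallP => [h C|h u]; rewrite // -(repK C).
Qed.

(** Choose a sorted labelling [b] of content [al]; both sides then count the permutations increasing
    on its blocks. The size [m] may be below [n], as the recursion on contents requires. *)
Lemma card_mset_words al : \sum_a al a <= n ->
  #|mset nc n al| = count_words (\sum_a al a) al.
Proof.
move=> aln; set m := \sum_a al a.
have [||b [bm bc]] := @label_mono_exists m 'I_k (fun i j : 'I_k => i <= j) _ _ al erefl.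
- by move=> i j; apply: leq_total.
- by move=> i j l; apply: leq_trans.
have E : count_words m al = count_words m (fun a => #|[set x | b x == a]|).
  by apply: eq_card => t; rewrite !inE; apply: eq_forallb => a; rewrite bc.
have -> : mset nc n al = mset nc n (fun a => #|[set x | b x == a]|).
  by apply: eq_mset => a; rewrite bc.
rewrite E -card_fmono_words.
transitivity #|[set p | fmono false b p && predT p]|; last first.
  by apply: eq_card => p; rewrite !inE andbT.
rewrite (@card_perm_mset N' k n nN m b bm aln false predT predT) //.
by apply: eq_card => M; rewrite [RHS]inE andbT.
Qed.

Lemma mset_rec al : \sum_a al a <= n ->
  #|mset nc n al| = [forall a, al a == 0] + \sum_(a | 0 < al a) #|mset nc n (lower al a)|.
Proof.
move=> aln; rewrite card_mset_words //.
transitivity ([forall a, al a == 0] +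
    \sum_(a | 0 < al a) count_words (\sum_x lower al a x) (lower al a)); last first.
  congr (_ + _); apply: eq_bigr => a a0; rewrite card_mset_words //.
  by apply: leq_trans aln; rewrite (sum_lower a0).
case E : (\sum_a al a) => [|m].
  rewrite count_words0 big1 ?addn0 // => a a0.
  by move: E; rewrite (sum_lower a0).
rewrite count_wordsS; case: forallP => [h|_]; first by rewrite big1 // in E => a _; apply/eqP.
rewrite add0n; apply: eq_bigr => a a0.
by have := E; rewrite (sum_lower a0) => -[<-].
Qed.

Variable (b : 'I_n -> 'I_k).
Hypothesis b_mono : forall x y : 'I_n, x < y -> b x <= b y.
Local Notation mof := (@mset_of N' k n n b).
Local Notation al := (fun a : 'I_k => #|[set x | b x == a]|).

Lemma sum_al : \sum_a al a = n.
Proof.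
rewrite -[RHS]card_ord -sum1_card (partition_big b predT) //=.
by apply: eq_bigr => a _; rewrite -sum1_card; apply: eq_bigl => x; rewrite inE.
Qed.

Let mofE p u : mof p (neckl u) = mult b p u :> nat.
Proof. exact: mset_ofE. Qed.

Lemma OC_mset (p : {perm 'I_n}) : fiber_mono false b p ->
  [forall x, odd #|porbit p x|] = odd_supp nc (mof p).
Proof.
move=> pm; rewrite (OC_inc nN pm) /odd_supp -forall_neckl.
by apply: eq_forallb => u; rewrite weight_neckl mofE.
Qed.

Lemma EC_even_mset (p : {perm 'I_n}) : fiber_mono true b p ->
  [forall x, ~~ odd #|porbit p x|] = even_on_odd nc (mof p).
Proof.
move=> pm; rewrite (EC_even_dec nN pm) /even_on_odd -forall_neckl.
by apply: eq_forallb => u; rewrite weight_neckl mofE.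
Qed.

Lemma EC_odd_mset (p : {perm 'I_n}) : fiber_mono true b p ->
  (#|[set x | p x == x]| == 1) &&
    [forall x, (#|porbit p x| != 1) ==> ~~ odd #|porbit p x|] =
  one_odd_loop nc (mof p).
Proof.
move=> pm; rewrite (EC_odd_dec nN pm) (card_fix_dec nN pm) /one_odd_loop -forall_neckl.
congr (_ && _); last by apply: eq_forallb => u; rewrite weight_neckl mofE per_eq1.
(* Necklaces of length one correspond through [rep] to shift-invariant words. *)
rewrite -[in RHS](card_imset _ (can_inj (@repK N' k))); congr (_ == _); apply: eq_card => u.
apply/idP/imsetP => [|[C]]; rewrite !inE; last first.
  by rewrite -{1 2}(repK C) weight_neckl per_eq1 mofE => uC ->.
move=> /andP[/eqP su ou]; exists (neckl u).
  by rewrite inE weight_neckl per_eq1 su eqxx mofE.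
have : rep (neckl u) \in val (neckl u) by rewrite mem_neckl repK.
have -> : val (neckl u) = [set u] by apply/eqP; rewrite -neckl_fixE // mem_neckl.
by rewrite inE => /eqP.
Qed.

Lemma card_OC_EC_blocks :
  #|[set p : {perm 'I_n} | fmono false b p && [forall x, odd #|porbit p x|]]| =
  #|[set p : {perm 'I_n} | fmono true b p &&
     (if odd n then (#|[set x | p x == x]| == 1) &&
         [forall x, (#|porbit p x| != 1) ==> ~~ odd #|porbit p x|]
      else [forall x, ~~ odd #|porbit p x|])]|.
Proof.
rewrite (card_perm_mset nN b_mono (leqnn n) OC_mset).
have an : \sum_a al a <= n by rewrite sum_al.
case: (boolP (odd n)) => on /=.
  rewrite (card_perm_mset nN b_mono (leqnn n) EC_odd_mset).
  apply: (card_one_odd_loop_odd (@weight_gt0 N' k) mset_rec (@ncontent_loop N' k)) => //.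
    exact: weight1_loop.
  by rewrite sum_al.
rewrite (card_perm_mset nN b_mono (leqnn n) EC_even_mset).
by rewrite (card_even_on_odd_even (@weight_gt0 N' k) mset_rec) // sum_al.
Qed.

End Main.

(** * Descent sets *)

Section DescentBlocks.
Variables (n : nat) (I : {set 'I_n.-1}).

(** This label grows by one just after each position in [I], so its level sets are the blocks cut
    out by [I]. *)
Definition block (x : nat) := #|[set i in I | i < x]|.

Lemma block_lt x : block x < n.+1.
Proof.
rewrite ltnS; apply: leq_trans (leq_pred n).
by rewrite -[X in _ <= X]card_ord max_card.
Qed.

Definition block_ord (x : 'I_n) : 'I_n.+1 := Ordinal (block_lt x).

Lemma block_mono x y : x <= y -> block x <= block y.
Proof.
move=> xy; apply/subset_leq_card/subsetP => i; rewrite !inE => /andP[-> ix].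
exact: leq_trans xy.
Qed.

Lemma block_eq x y (i : 'I_n.-1) : x <= i -> i < y -> block x = block y -> i \notin I.
Proof.
move=> xi iy E; apply/negP => iI; have : block x < block y; last by rewrite E ltnn.
apply: proper_card; apply/properP; split.
  apply/subsetP => j; rewrite !inE => /andP[-> jx].
  exact: leq_trans jx (leq_trans xi (ltnW iy)).
by exists i; rewrite !inE iI ?iy // -leqNgt.
Qed.

Lemma block_step (i : 'I_n.-1) : i \notin I -> block i = block i.+1.
Proof.
move=> iI; apply: eq_card => j; rewrite !inE ltnS [j <= i]leq_eqVlt.
by case: (j =P i :> nat) => [/ord_inj ->|]; rewrite ?(negbTE iI).
Qed.

(** No position of [I] separates two points of a block, so the comparisons of neighbours chain by
    transitivity. *)
Lemma fmono_block e (p : 'S_n) :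
  fmono e block_ord p = [forall (i | i \notin I), ltx e (p (pos_left i)) (p (pos_right i))].
Proof.
apply/fmonoP/forall_inP => [pm i iI|h x y bxy].
  by apply: pm => //; apply: val_inj; apply: block_step.
have {}bxy : block x = block y := congr1 val bxy.
have step (u v : 'I_n) : v = u.+1 :> nat -> block u = block v -> ltx e (p u) (p v).
  move=> vu buv; have un : u < n.-1 by rewrite ltn_predRL -vu.
  have -> : u = pos_left (Ordinal un) by apply: val_inj.
  have -> : v = pos_right (Ordinal un) by apply: val_inj.
  by apply: h; apply: block_eq buv; rewrite /= ?vu.
move=> xy; have [d yd] : exists d, y = x + d.+1 :> nat.
  by exists (y - x).-1; rewrite prednK ?subn_gt0 // subnKC // ltnW.
elim: d y yd bxy {xy} => [|d IH] y yd bxy; first by apply: step; rewrite // yd addn1.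
have zn : x + d.+1 < n by apply: leq_ltn_trans (ltn_ord y); rewrite yd leq_add2l.
have bz : block x = block (x + d.+1).
  apply/eqP; rewrite eqn_leq block_mono ?leq_addr //= bxy.
  by rewrite block_mono // yd leq_add2l.
apply: ltx_trans (IH (Ordinal zn) erefl bz) _; apply: step; first by rewrite yd addnS.
by rewrite -bxy bz.
Qed.

End DescentBlocks.

(** * From descent sets contained in a set to exact descent sets *)

(** Induction on the size of [I]: the terms of proper subsets agree and cancel. *)
Lemma subset_sum_inj (T : finType) (f g : {set T} -> nat) :
    (forall I : {set T}, \sum_(J : {set T} | J \subset I) f J =
                         \sum_(J : {set T} | J \subset I) g J) ->
  f =1 g.
Proof.
move=> fg I; have [l] := ubnP #|I|; elim: l I => // l IH I; rewrite ltnS => Il.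
have := fg I; rewrite (bigD1 I) //= [in RHS](bigD1 I) //=.
rewrite (eq_bigr g) => [/addIn //|J /andP[JI NJ]].
by apply: IH; apply: leq_trans Il; apply: proper_card; rewrite properEneq NJ.
Qed.

Lemma card_by_subset (T U : finType) (A : {set T}) (F : T -> {set U}) (I : {set U}) :
  #|[set p in A | F p \subset I]| = \sum_(J : {set U} | J \subset I) #|[set p in A | F p == J]|.
Proof.
rewrite -sum1_card (partition_big F (fun J => J \subset I)) /=; last first.
  by move=> p; rewrite inE => /andP[].
apply: eq_bigr => J JI; rewrite -sum1_card; apply: eq_bigl => p; rewrite !inE.
by case: (F p =P J) => [->|]; rewrite ?JI ?andbT ?andbF.
Qed.

Lemma forall_porbits (T : finType) (s : {perm T}) (P : pred nat) :
  [forall C in porbits s, P #|C|] = [forall x, P #|porbit s x|].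
Proof.
apply/forall_inP/forallP => [h x|h C /imsetP[x _ ->] //].
by apply: h; apply: imset_f.
Qed.

Theorem theorem1p1 (n : nat) (hn : 0 < n) (J : {set 'I_n.-1}) :
  #|[set p in OC n | Des p == J]| = #|[set p in EC n | Des p == ~: J]|.
Proof.
(* Complementing [Des p] instead of [K] lets both sides be summed over the subsets of one set
   [I]. *)
have EcJ (K : {set 'I_n.-1}) :
    #|[set p in EC n | Des p == ~: K]| = #|[set p in EC n | ~: Des p == K]|.
  by apply: eq_card => p; rewrite !inE -(inj_eq (@setC_inj _)) setCK.
rewrite EcJ; move: J.
apply: (@subset_sum_inj _ (fun J => #|[set p in OC n | Des p == J]|)
                          (fun J => #|[set p in EC n | ~: Des p == J]|)) => I.
rewrite -(card_by_subset (OC n)) -(card_by_subset (EC n) (fun p => ~: Des p)).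
(* The words have length the factorial of [n], written in the form [N'.+1]. *)
have n_fact : n`! %| (n`!).-1.+1 by rewrite prednK ?fact_gt0.
have bm (x y : 'I_n) : x < y -> block_ord I x <= block_ord I y.
  by move=> xy; apply: block_mono; apply: ltnW.
have := card_OC_EC_blocks n_fact bm.
congr (_ = _); apply: eq_card => p; rewrite [LHS]inE [RHS]inE andbC.
  rewrite fmono_block -(forall_porbits p odd) [p \in _]inE; congr (_ && _).
  apply/forall_inP/subsetP => [h i|h i iI].
    by rewrite inE; apply: contraTT => iI; rewrite -leqNgt; apply: ltnW; apply: h.
  (* A position outside [I] is no descent, and injectivity of [p] makes the ascent strict. *)
  rewrite /ltx ltn_neqAle (inj_eq (@ord_inj _)) (inj_eq perm_inj) -val_eqE /=.
  rewrite (ltn_eqF (ltnSn i)) /= leqNgt; apply: contra iI => lt.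
  by apply: h; rewrite inE.
rewrite fmono_block; congr (_ && _).
  rewrite /EC; case: (odd n); rewrite inE.
    by rewrite (forall_porbits p (fun l => (l != 1) ==> ~~ odd l)).
  by rewrite (forall_porbits p (fun l => ~~ odd l)).
apply/forall_inP/subsetP => [h i|h i iI].
  by rewrite !inE; apply: contraNT => /h.
by have := contra (h i) iI; rewrite !inE negbK.
Qed.
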